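(* Let $H$ be a separable infinite-dimensional Hilbert space, let $K,T$ be bounded linear operators on $H$, and let $(f_j,c_j)_{j\in\mathbb{Z}}$ be a $K_s$-frame. If $TK=KT$ and $T^*$ is an isometry, then $(Tf_j,c_j)_{j\in\mathbb{Z}}$ is a $K_s$-frame.
   Context: A sequence $\{f_j\}_{j\in\mathbb{Z}}\subseteq H$ is a $K$-frame if there are constants $A,B>0$ with $A\|K^*f\|^2\le\sum_{j\in\mathbb{Z}}|\langle f,f_j\rangle|^2\le B\|f\|^2$ for every $f\in H$. A $K$-frame $\{f_j\}_{j\in\mathbb{Z}}$ is a $K_s$-frame with scaling $\{c_j\}_{j\in\mathbb{Z}}\in\ell^\infty(\mathbb{Z})$, denoted $(f_j,c_j)_{j\in\mathbb{Z}}$, if $\{c_jf_j\}_{j\in\mathbb{Z}}$ is a Parseval $K$-frame, i.e. $\sum_{j\in\mathbb{Z}}|\langle f,c_jf_j\rangle|^2=\|K^*f\|^2$ for every $f\in H$. *)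

(* Defs.v *)
From mathcomp Require Import all_boot all_order all_algebra.
From mathcomp Require Import complex.
From mathcomp Require Import sesquilinear.
From mathcomp Require Import all_classical all_reals all_analysis.

Set Implicit Arguments.
Unset Strict Implicit.
Unset Printing Implicit Defensive.

Import Order.TTheory GRing.Theory Num.Theory.
Import numFieldNormedType.Exports.

Local Open Scope classical_set_scope.
Local Open Scope ring_scope.

(* Hilbert spaces are taken over the reals or over the complex numbers; every
   definition below is uniform in the choice. *)
Variant scalar_kind := RealScalars | ComplexScalars.

Definition scalar_field (R : realType) (k : scalar_kind) : numFieldType :=
  match k with RealScalars => R | ComplexScalars => R[i] end.

Definition scalar_conj (R : realType) (k : scalar_kind) :
    scalar_field R k -> scalar_field R k :=
  match k with RealScalars => idfun | ComplexScalars => Num.conj end.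
Arguments scalar_conj : clear implicits.

Definition scalar_Re (R : realType) (k : scalar_kind) : scalar_field R k -> R :=
  match k with
  | RealScalars => idfun
  | ComplexScalars => @complex.Re R
  end.

(* MathComp norms take their values in the field of scalars; [rnorm] is the
   same norm with values in [R].  It applies both to vectors and to scalars. *)
Definition rnorm (R : realType) (k : scalar_kind)
    (V : normedZmodType (scalar_field R k)) (x : V) : R := scalar_Re `|x|.

(* [dot] is linear in its first argument and conjugate-linear in its second. *)
Definition norm_from_dot (R : realType) (k : scalar_kind)
    (H : normedModType (scalar_field R k)) (dot : {dot H for scalar_conj R k}) :=
  forall x : H, `|x| ^+ 2 = dot x x.

Definition separable_space (T : topologicalType) :=
  exists D : set T, countable D /\ dense D.

Definition infinite_dimensional (F : numFieldType) (V : lmodType F) :=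
  forall (n : nat) (v : 'I_n -> V),
    exists x : V, forall a : 'I_n -> F, x <> \sum_i a i *: v i.

Section KFrames.
Variables (R : realType) (k : scalar_kind).
Variable H : completeNormedModType (scalar_field R k).
Variable dot : {dot H for scalar_conj R k}.

Definition bounded_operator (T : H -> H) :=
  exists M : R, forall x : H, rnorm (T x) <= M * rnorm x.

(* For a bounded linear [T] on a Hilbert space, the Riesz representation
   theorem provides exactly one [z] for each [y]. *)
Definition adjoint (T : H -> H) (y : H) : H :=
  get [set z : H | forall x : H, dot (T x) y = dot x z].

Definition isometric (T : H -> H) := forall x : H, rnorm (T x) = rnorm x.

(* A series of nonnegative terms indexed by the integers: the supremum of its
   finite partial sums, possibly +oo. *)
Definition frame_sum (f : int -> H) (x : H) : \bar R :=
  \esum_(j in [set: int]) (rnorm (dot x (f j)) ^+ 2)%:E.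

Definition K_frame (K : H -> H) (f : int -> H) :=
  exists A B : R, [/\ 0 < A, 0 < B & forall x : H,
    ((A * rnorm (adjoint K x) ^+ 2)%:E <= frame_sum f x)%E /\
    (frame_sum f x <= (B * rnorm x ^+ 2)%:E)%E].

Definition Parseval_K_frame (K : H -> H) (f : int -> H) :=
  forall x : H, frame_sum f x = (rnorm (adjoint K x) ^+ 2)%:E.

Definition in_linfty (c : int -> scalar_field R k) :=
  exists M : R, forall j : int, rnorm (c j) <= M.

Definition Ks_frame (K : H -> H) (f : int -> H) (c : int -> scalar_field R k) :=
  [/\ K_frame K f, in_linfty c & Parseval_K_frame K (fun j => c j *: f j)].

End KFrames.

(* Main.v *)
(* Since [<x, T f_j> = <T^* x, f_j>], the frame sums of [T f_j] at [x] are those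
   of [f_j] at [T^* x]; and [K^* T^* = T^* K^*] with [T^*] isometric gives
   [|K^* (T^* x)| = |K^* x|].  The existence of the adjoints is the Riesz
   representation theorem, proved by minimizing [|x|^2 - 2 Re phi x]. *)

Require Import Defs.
From mathcomp Require Import all_boot all_order all_algebra.
From mathcomp Require Import complex.
From mathcomp Require Import sesquilinear.
From mathcomp Require Import all_classical all_reals all_analysis.
From mathcomp Require Import ring lra.

Set Implicit Arguments.
Unset Strict Implicit.
Unset Printing Implicit Defensive.

Import Order.TTheory GRing.Theory Num.Theory.
Import numFieldNormedType.Exports.

Local Open Scope classical_set_scope.
Local Open Scope ring_scope.

(** * Real and complex scalars treated uniformly *)

Definition of_real (R : realType) (k : scalar_kind) : R -> scalar_field R k :=
  match k with RealScalars => idfun | ComplexScalars => real_complex R end.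
Arguments of_real : clear implicits.

Section Scalars.
Variables (R : realType) (k : scalar_kind).
Local Notation F := (scalar_field R k).
Implicit Types (a b : F) (r s : R).

Lemma scalar_ReD a b : scalar_Re (a + b) = scalar_Re a + scalar_Re b.
Proof. by case: k a b => //= [[x y]] [x' y']. Qed.

Lemma scalar_ReN a : scalar_Re (- a) = - scalar_Re a.
Proof. by case: k a => //= [[x y]]. Qed.

Lemma of_realK r : scalar_Re (of_real R k r) = r.
Proof. by case: k. Qed.

Lemma scalar_Re_of_realM r a : scalar_Re (of_real R k r * a) = r * scalar_Re a.
Proof. by case: k a => //= [[x y]] /=; rewrite mul0r subr0. Qed.

Lemma scalar_Re_conj a : scalar_Re (scalar_conj R k a) = scalar_Re a.
Proof. by case: k a => //= [[x y]]. Qed.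

Lemma mul_scalar_conj a : scalar_conj R k a * a = `|a| ^+ 2.
Proof.
case: k a => /= a; first by rewrite real_normK ?num_real// expr2.
by rewrite mulrC normCK.
Qed.

Lemma of_real_Re_ge0 a : 0 <= a -> of_real R k (scalar_Re a) = a.
Proof. by case: k a => //= a a0; rewrite RRe_real// ger0_real. Qed.

Lemma norm_of_real r : `|of_real R k r| = of_real R k `|r|.
Proof. by case: k => //=; rewrite normc_def /= expr0n addr0 sqrtr_sqr. Qed.

Lemma ler_of_real r s : (of_real R k r <= of_real R k s) = (r <= s).
Proof. by case: k => //=; rewrite lecR. Qed.

Lemma ltr_of_real r s : (of_real R k r < of_real R k s) = (r < s).
Proof. by case: k => //=; rewrite ltcR. Qed.

Lemma of_realM r s : of_real R k (r * s) = of_real R k r * of_real R k s.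
Proof. by case: k => //=; rewrite rmorphM. Qed.

Lemma scalar_Re0 : scalar_Re (0 : F) = 0.
Proof. by case: k. Qed.

Lemma of_real0 : of_real R k 0 = 0.
Proof. by case: k. Qed.

End Scalars.


Section RealNorm.
Variables (R : realType) (k : scalar_kind).
Variable V : normedZmodType (scalar_field R k).
Implicit Types x y : V.

Lemma of_real_rnorm x : of_real R k (rnorm x) = `|x|.
Proof. exact: of_real_Re_ge0. Qed.

Lemma rnorm_ge0 x : 0 <= rnorm x.
Proof. by rewrite -(ler_of_real k) of_real0 of_real_rnorm. Qed.

Lemma rnorm0_eq0 x : rnorm x = 0 -> x = 0.
Proof. by move=> x0; apply/normr0_eq0; rewrite -of_real_rnorm x0 of_real0. Qed.

End RealNorm.

(** * The real part of the inner product and Riesz representation *)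

Section RealInnerProduct.
Variables (R : realType) (k : scalar_kind).
Variable H : completeNormedModType (scalar_field R k).
Variable dot : {dot H for scalar_conj R k}.
Hypothesis hdot : norm_from_dot dot.
Implicit Types (x y z : H) (r : R).

Lemma dotC x y : dot x y = scalar_conj R k (dot y x).
Proof. by rewrite hermitian_subproof expr0 mul1r. Qed.

Lemma dotZl a x y : dot (a *: x) y = a * dot x y.
Proof. exact: linearZl_LR. Qed.

Lemma dot_injr y z : (forall x, dot x y = dot x z) -> y = z.
Proof.
move=> yz; have yz0 : dot (y - z) (y - z) = 0.
  by rewrite linearBr; apply/eqP; rewrite subr_eq0; exact/eqP/yz.
apply/eqP; rewrite -subr_eq0; apply/negPn/negP => /(neq0_dnorm_gt0 (s := dot)).
by rewrite [ltRHS]yz0 ltxx.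
Qed.

(** A real inner product inducing the same norm, so the minimization below runs over [R] for both
    kinds of scalars. *)
Definition rdot x y : R := scalar_Re (dot x y).

Lemma rdotC x y : rdot x y = rdot y x.
Proof. by rewrite /rdot dotC scalar_Re_conj. Qed.

Lemma rdotDl x y z : rdot (x + y) z = rdot x z + rdot y z.
Proof. by rewrite /rdot linearDl scalar_ReD. Qed.

Lemma rdotDr x y z : rdot z (x + y) = rdot z x + rdot z y.
Proof. by rewrite /rdot linearDr scalar_ReD. Qed.

Lemma rdotZl r x y : rdot (of_real R k r *: x) y = r * rdot x y.
Proof. by rewrite /rdot dotZl scalar_Re_of_realM. Qed.

Lemma rdotZr r x y : rdot x (of_real R k r *: y) = r * rdot x y.
Proof. by rewrite rdotC rdotZl rdotC. Qed.

Lemma rdotNr x y : rdot x (- y) = - rdot x y.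
Proof. by rewrite /rdot linearNr scalar_ReN. Qed.

Lemma rdot0r x : rdot x 0 = 0.
Proof. by rewrite /rdot linear0r scalar_Re0. Qed.

Lemma sqr_rnorm x : rnorm x ^+ 2 = rdot x x.
Proof.
by rewrite /rdot -hdot -of_real_rnorm [in RHS]expr2 -of_realM of_realK expr2.
Qed.

Lemma sqr_rnormD x y :
  rnorm (x + y) ^+ 2 = rnorm x ^+ 2 + 2 * rdot x y + rnorm y ^+ 2.
Proof. by rewrite !sqr_rnorm rdotDl !rdotDr (rdotC y x); ring. Qed.

Lemma rnormZ r x : rnorm (of_real R k r *: x) = `|r| * rnorm x.
Proof.
by rewrite {1}/rnorm normrZ norm_of_real -of_real_rnorm -of_realM of_realK.
Qed.

Lemma rnormN x : rnorm (- x) = rnorm x.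
Proof. by rewrite /rnorm normrN. Qed.

(** Cauchy-Schwarz: for [u = |y| x - |x| y], expanding [0 <= |u|^2] gives
    [0 <= 2 |x| |y| (|x| |y| - rdot x y)]; the degenerate cases are treated apart. *)
Lemma rdot_le x y : rdot x y <= rnorm x * rnorm y.
Proof.
have := sqr_rnormD (of_real R k (rnorm y) *: x) (of_real R k (- rnorm x) *: y).
rewrite rdotZl rdotZr !rnormZ normrN !ger0_norm ?rnorm_ge0//.
set u := _ *: _ + _; have := sqr_ge0 (rnorm u); move: (rnorm u) => w w0 wE.
have := rnorm_ge0 y; rewrite le_eqVlt => /predU1P[/esym/rnorm0_eq0 ->|y0].
  by rewrite rdot0r mulr_ge0 ?rnorm_ge0.
have := rnorm_ge0 x; rewrite le_eqVlt => /predU1P[/esym/rnorm0_eq0 ->|x0].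
  by rewrite rdotC rdot0r mulr_ge0 ?rnorm_ge0.
rewrite -subr_ge0 -(pmulr_rge0 _ (mulr_gt0 x0 y0)); nra.
Qed.

(* The parallelogram law makes the sublevel sets of [J] near its infimum small
   in diameter, so completeness provides a minimizer, at which the derivative
   of [J] vanishes. *)
Lemma real_riesz (phi : H -> R) (C : R) :
  (forall x y, phi (x + y) = phi x + phi y) ->
  (forall r x, phi (of_real R k r *: x) = r * phi x) ->
  0 <= C -> (forall x, phi x <= C * rnorm x) ->
  exists z, forall x, phi x = rdot x z.
Proof.
move=> phiD phiZ C0 phi_le.
pose J x := rnorm x ^+ 2 - 2 * phi x.
pose m := inf (range J).
(* [|x|^2 - 2 C |x| = (|x| - C)^2 - C^2]. *)
have J_ge x : - C ^+ 2 <= J x.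
  have := phi_le x; have := sqr_ge0 (rnorm x - C); rewrite /J; nra.
have hJ : has_inf (range J).
  split; first by exists (J 0), 0.
  by exists (- C ^+ 2) => _ [x _ <-].
have m_le x : m <= J x by apply: ge_inf; [case: hJ|exists x].
pose S (e : R) := [set x | J x < m + e].
have JD x y : J (x + y) = J x + J y + 2 * rdot x y.
  by rewrite /J sqr_rnormD phiD; ring.
have JZ r x : J (of_real R k r *: x) = r ^+ 2 * rnorm x ^+ 2 - 2 * r * phi x.
  by rewrite /J rnormZ phiZ exprMn real_normK ?num_real//; ring.
(* The midpoint has [J] at least [m], and [|x - y|^2 = 2 J x + 2 J y - 4 J ((x + y) / 2)]. *)
have S_small e x y : S e x -> S e y -> rnorm (x - y) ^+ 2 < 4 * e.
  rewrite /S /= => Sx Sy.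
  have := m_le (of_real R k (2^-1) *: (x + y)).
  rewrite JZ phiD sqr_rnormD; move: Sx Sy; rewrite /J => Sx Sy.
  rewrite sqr_rnormD rdotNr rnormN; lra.
(* This filter plays the role of a minimizing sequence. *)
pose G := filter_from [set e : R | 0 < e] S.
have GF : ProperFilter G.
  apply: filter_from_proper; last first.
    move=> e /= e0; have [_ [x _ <-] Jx] := inf_adherent e0 hJ.
    by exists x.
  apply: filter_from_filter; first by exists 1; rewrite /= ltr01.
  move=> e1 e2 /= e10 e20.
  exists (Num.min e1 e2); first by rewrite /= lt_min e10.
  move=> x /=; rewrite /S /= => Jx; split=> /=; apply: lt_le_trans Jx _;
    by rewrite lerD2l ge_min lexx ?orbT.
have norm_lt (x : H) (e : R) :
    0 < e -> rnorm x ^+ 2 < e ^+ 2 -> `|x| < of_real R k e.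
  move=> e0; rewrite ltr_pXn2r ?nnegrE ?rnorm_ge0 ?ltW// => xe.
  by rewrite -of_real_rnorm ltr_of_real.
have : cvg G.
  apply: cauchy_cvg; apply: cauchy_exP => eps eps0.
  have epsE := of_real_Re_ge0 (ltW eps0).
  set e := scalar_Re eps in epsE.
  have e0 : 0 < e by rewrite -(ltr_of_real k) epsE of_real0.
  (* By [S_small], this level gives a diameter below [e]. *)
  have d0 : 0 < e ^+ 2 / 4 by rewrite divr_gt0 ?exprn_gt0.
  have [_ [x _ <-] Jx] := inf_adherent d0 hJ.
  exists x, (e ^+ 2 / 4) => // y Sy.
  rewrite -ball_normE /= -epsE; apply: norm_lt => //.
  by apply: lt_le_trans (S_small _ _ _ Jx Sy) _; lra.
set z := lim G => Gz.
(* Quantitative continuity of [J]: [J z - J x <= 2 (|z| + C) |z - x|]. The [+ 1] in [K] only keeps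
   it positive. *)
have Jz_le : J z <= m.
  apply/ler_addgt0Pr => eta eta0.
  pose K := 2 * (rnorm z + C) + 1.
  have K0 : 0 < K by have := rnorm_ge0 z; rewrite /K; lra.
  pose e := eta / 2 / K.
  have e0 : 0 < e by rewrite !divr_gt0.
  have : G (ball z (of_real R k e)).
    by apply: Gz; apply: nbhsx_ballx; rewrite -(of_real0 R k) ltr_of_real.
  case=> d /= d0 Sd.
  (* The minimum puts [x] both in [S d], hence close to [z], and within [eta / 2] of the infimum. *)
  have d'0 : 0 < Num.min d (eta / 2) by rewrite lt_min d0 divr_gt0.
  have [_ [x _ <-]] := inf_adherent d'0 hJ.
  rewrite -/m => Jx.
  have Sx : S d x.
    by apply: lt_le_trans Jx _; rewrite lerD2l ge_min lexx.
  have Jx2 : J x < m + eta / 2.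
    by apply: lt_le_trans Jx _; rewrite lerD2l ge_min lexx orbT.
  have := Sd _ Sx; rewrite -ball_normE /= -of_real_rnorm ltr_of_real => zx.
  have Jz :
      J z = J x - rnorm (z - x) ^+ 2 + 2 * rdot z (z - x) + 2 * phi (x - z).
    have phiN : phi (z - x) + phi (x - z) = 0.
      by rewrite -phiD subrKA subrr -(scale0r 0) -(of_real0 R k) phiZ mul0r.
    have : rdot (x + (z - x)) (z - x) = rdot z (z - x) by rewrite subrKC.
    rewrite rdotDl -sqr_rnorm; have := JD x (z - x); rewrite subrKC => ->.
    by rewrite /J => zE; lra.
  have := rdot_le z (z - x); have := phi_le (x - z).
  rewrite -[rnorm (x - z)]rnormN opprB.
  have : (rnorm z + C) * rnorm (z - x) <= (rnorm z + C) * e.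
    by rewrite ler_wpM2l ?addr_ge0 ?rnorm_ge0// ltW.
  have : K * e = eta / 2 by rewrite /e mulrCA divff ?mulr1 ?gt_eqF.
  have := sqr_ge0 (rnorm (z - x)); rewrite /K; lra.
exists z => x; apply/eqP; rewrite eq_sym -subr_eq0; apply/eqP.
set b := _ - _.
pose n := rnorm x ^+ 2.
have n1 : 0 < 1 + n by rewrite ltr_pwDl ?sqr_ge0.
(* Minimality along [x] reads [0 <= t^2 n + 2 t b]. At [t = - b / (1 + n)] the right side is
   [- t^2 (2 + n)], so [t = 0] and [b = 0]; the denominator [1 + n] also covers [x = 0]. *)
have := le_trans Jz_le (m_le (z + of_real R k (- b / (1 + n)) *: x)).
rewrite JD JZ rdotZr -/n.
set t := - b / (1 + n) => Jt.
have tE : t * (1 + n) = - b by rewrite /t mulfVK ?gt_eqF.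
have bE : b = rdot z x - phi x by rewrite /b rdotC.
have : t ^+ 2 * (2 + n) <= 0.
  have -> : t ^+ 2 * (2 + n) = - (t ^+ 2 * n + 2 * t * b).
    by rewrite (_ : b = - (t * (1 + n))); [ring | rewrite tE opprK].
  rewrite bE; lra.
have n2 : 0 < 2 + n by lra.
rewrite pmulr_lle0// real_exprn_even_le0 ?num_real//= => /eqP t0.
by move: tE; rewrite t0 mul0r => /esym/eqP; rewrite oppr_eq0 => /eqP.
Qed.

(** * Adjoints and frame sums *)

Lemma adjointP (T : {linear H -> H}) x y :
  bounded_operator T -> dot (T x) y = dot x (adjoint dot T y).
Proof.
move=> [M TM]; suff [z zP] : exists z, forall u, dot (T u) y = dot u z.
  by apply: (getPex (P := [set z | forall u, dot (T u) y = dot u z])); exists z.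
(* [real_riesz] represents only the real part of [dot (T u) y]. The bound uses [|M|] because [M] may
   be negative. *)
have [|||u|z zP] := @real_riesz (fun u => rdot (T u) y) (`|M| * rnorm y).
- by move=> u v; rewrite linearD rdotDl.
- by move=> r u; rewrite linearZ rdotZl.
- by rewrite mulr_ge0 ?rnorm_ge0.
- apply: le_trans (rdot_le _ _) _; rewrite mulrAC ler_wpM2r ?rnorm_ge0//.
  by apply: le_trans (TM u) _; rewrite ler_wpM2r ?rnorm_ge0 ?ler_norm.
(* Testing the real identity at [conj a *: u], where [a] is the discrepancy of
   the complex one, gives [|a|^2 = 0]. *)
exists z => u; apply/eqP; rewrite -subr_eq0; apply/eqP.
set a := _ - _; apply: (rnorm0_eq0 (V := scalar_field R k)).
have := zP (scalar_conj R k a *: u).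
rewrite linearZ /rdot !dotZl => /eqP; rewrite -subr_eq0 -scalar_ReN -scalar_ReD.
rewrite -mulrBr -/a mul_scalar_conj -of_real_rnorm expr2 -of_realM of_realK.
by rewrite -expr2 sqrf_eq0 => /eqP.
Qed.

(** Paired with [y], the two sides give [dot (T (S y)) x] and [dot (S (T y)) x]. *)
Lemma adjoint_comm (S T : {linear H -> H}) x :
  bounded_operator S -> bounded_operator T -> (forall y, T (S y) = S (T y)) ->
  adjoint dot S (adjoint dot T x) = adjoint dot T (adjoint dot S x).
Proof.
move=> bS bT TS; apply: dot_injr => y.
by rewrite -!adjointP// TS.
Qed.

Lemma frame_sum_image (T : {linear H -> H}) (g : int -> H) x :
  bounded_operator T ->
  frame_sum dot (fun j => T (g j)) x = frame_sum dot g (adjoint dot T x).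
Proof.
move=> bT; apply: eq_esum => j _.
by rewrite dotC adjointP// -dotC.
Qed.

End RealInnerProduct.

Theorem theorem3p2 (R : realType) (k : scalar_kind)
  (H : completeNormedModType (scalar_field R k))
  (dot : {dot H for scalar_conj R k}) (hdot : norm_from_dot dot)
  (hsep : separable_space H) (hinf : infinite_dimensional H)
  (K T : {linear H -> H})
  (hK : bounded_operator K) (hT : bounded_operator T)
  (f : int -> H) (c : int -> scalar_field R k)
  (hf : Ks_frame dot K f c)
  (hTK : forall x : H, T (K x) = K (T x))
  (hiso : isometric (adjoint dot T)) :
  Ks_frame dot K (fun j => T (f j)) c.
Proof.
have [[A [B [A0 B0 fAB]]] cb fP] := hf.
have normK x :
    rnorm (adjoint dot K (adjoint dot T x)) = rnorm (adjoint dot K x).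
  by rewrite adjoint_comm// hiso.
split=> //.
  (* The old bounds at [adjoint dot T x] are the new ones at [x], with the same constants. *)
  exists A, B; split=> // x; rewrite frame_sum_image// -normK -(hiso x).
  exact: fAB.
(* Linearity makes the scaled family the image under [T] of the Parseval family. *)
have -> : (fun j => c j *: T (f j)) = (fun j => T (c j *: f j)).
  by apply/funext => j; rewrite linearZ.
by move=> x; rewrite frame_sum_image// fP normK.
Qed.
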